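(* For Independent Set in the Late Reject model, the strict competitive ratio is $\lceil n/2\rceil$, where $n$ is the number of vertices of the input graph. That is: (i) there is an online algorithm $\mathrm{ALG}$ in the Late Reject model such that $\mathrm{OPT}(\sigma)\le \lceil n/2\rceil\,\mathrm{ALG}(\sigma)$ for every input $\sigma$ with $n\ge 1$ vertices; and (ii) for every online algorithm $\mathrm{ALG}$ in the Late Reject model and every integer $n\ge 1$, every real $c\ge 0$ such that $\mathrm{OPT}(\sigma)\le c\,\mathrm{ALG}(\sigma)$ for all inputs $\sigma$ with $n$ vertices satisfies $c\ge \lceil n/2\rceil$.
   Context: Online Independent Set (vertex arrival). An input $\sigma$ is a finite simple undirected graph $G=(V,E)$ together with an ordering of its vertices. Vertices arrive one by one in this order; when a vertex arrives, all edges between it and previously arrived vertices are revealed. All online algorithms are deterministic: each decision depends only on the part of the input revealed so far (in particular $n=|V|$ is not known in advance). After each arrival the algorithm maintains a set of currently accepted vertices, which must be an independent set of the graph revealed so far. $\mathrm{ALG}(\sigma)$ is the number of accepted vertices at the end of the input, and $\mathrm{OPT}(\sigma)$ is the maximum cardinality of an independent set of $G$; the objective is maximization. Late Reject model: upon arrival of a vertex the algorithm either accepts or rejects it; in addition, in any step it may remove (late-reject) any previously accepted vertices. Any rejection (at arrival or late) is irrevocable, i.e., a rejected vertex can never be accepted afterwards. *)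

(* Defs.v *)
(* MathComp; real numbers are an arbitrary [R : realType]. *)
From HB Require Import structures.
From mathcomp Require Import all_boot all_order all_algebra.
From mathcomp Require Import reals.

Set Implicit Arguments.
Unset Strict Implicit.
Unset Printing Implicit Defensive.

Import Order.TTheory GRing.Theory Num.Theory.
Local Open Scope ring_scope.

(* An input with n vertices: vertices are named by their arrival time, so the
   arrival order is the natural order of 'I_n. *)
Record input (n : nat) := Input {
  edges : {set {set 'I_n}};
  edgesP : [forall e in edges, #|e| == 2]
}.

Definition adj n (G : input n) (u v : 'I_n) : bool := [set u; v] \in edges G.

Definition independent n (G : input n) (S : {set 'I_n}) : bool :=
  [forall u in S, forall v in S, ~~ adj G u v].

Definition revealed_edges m n (le_mn : (m <= n)%N) (G : input n) :
    {set {set 'I_m}} :=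
  [set e : {set 'I_m} | widen_ord le_mn @: e \in edges G].

Lemma revealed_edgesP m n (le_mn : (m <= n)%N) (G : input n) :
  [forall e in revealed_edges le_mn G, #|e| == 2].
Proof.
apply/forall_inP => e; rewrite inE => /(forall_inP (edgesP G)).
have inj_w : injective (widen_ord le_mn).
  by move=> u v /(congr1 val) /= /val_inj.
by rewrite (card_imset _ inj_w).
Qed.

(* The part of G revealed after the first m arrivals. *)
Definition revealed m n (le_mn : (m <= n)%N) (G : input n) : input m :=
  Input (revealed_edgesP le_mn G).

(* [A m H] is the set of vertices that are accepted right after the m-th
   arrival when H is what has been revealed.  A deterministic algorithm's own
   past decisions are determined by H, and neither the future nor the final
   number of vertices is available to it. *)
Definition online_algorithm := forall m : nat, input m -> {set 'I_m}.

(* A vertex that has arrived and is not currently accepted has been rejected,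
   at arrival or later. *)
Definition late_reject (A : online_algorithm) : Prop :=
  (forall m (H : input m), independent H (A m H)) /\
  (forall m n (le_mn : (m <= n)%N) (G : input n) (v : 'I_m),
     v \notin A m (revealed le_mn G) -> widen_ord le_mn v \notin A n G).

Definition ALG (A : online_algorithm) n (G : input n) : nat := #|A n G|.

Definition OPT n (G : input n) : nat :=
  \max_(S : {set 'I_n} | independent G S) #|S|.

Definition strictly_competitive (R : realType) (A : online_algorithm)
    (n : nat) (c : R) : Prop :=
  forall G : input n, (OPT G)%:R <= c * (ALG A G)%:R.

(* Main.v *)
(* Upper bound: the algorithm keeps only the latest vertex as long as each
   vertex is adjacent to its predecessor; the first two consecutive vertices
   that are not adjacent are kept forever.  With two accepted vertices,
   OPT <= n <= 2 * uphalf n suffices.  With one, the arrival order is a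
   Hamiltonian path, so OPT <= uphalf n.

   Lower bound: the adversary makes every new vertex adjacent exactly to the
   currently accepted ones.  Then at most one vertex is ever accepted and the
   graph is a forest, hence 2-colourable, so OPT >= uphalf n. *)
Require Import Defs.
From mathcomp Require Import all_boot all_order all_algebra.
From mathcomp Require Import reals.
From mathcomp Require Import zify.

Set Implicit Arguments.
Unset Strict Implicit.
Unset Printing Implicit Defensive.

Import Order.TTheory GRing.Theory Num.Theory.
Local Open Scope ring_scope.

Lemma input_inj n (G H : input n) : edges G = edges H -> G = H.
Proof.
case: G H => [E EP] [F FP] /= eqEF; move: EP FP; rewrite eqEF => EP FP.
by congr Input; apply: bool_irrelevance.
Qed.

Lemma adjC n (G : input n) u v : adj G u v = adj G v u.
Proof. by rewrite /adj setUC. Qed.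

Lemma adjnn n (G : input n) u : adj G u u = false.
Proof.
apply/negbTE/negP; rewrite /adj setUid => /(forall_inP (edgesP G)).
by rewrite cards1.
Qed.

Lemma widen_ord_inj m n (le_mn : (m <= n)%N) : injective (widen_ord le_mn).
Proof. by move=> u v /(congr1 val) /= /val_inj. Qed.

Lemma adj_revealed m n (le_mn : (m <= n)%N) (G : input n) u v :
  adj (revealed le_mn G) u v = adj G (widen_ord le_mn u) (widen_ord le_mn v).
Proof. by rewrite /adj inE imsetU !imset_set1. Qed.

Lemma independentP n (G : input n) (S : {set 'I_n}) :
  reflect (forall u v, u \in S -> v \in S -> ~~ adj G u v) (independent G S).
Proof.
apply: (iffP forall_inP) => [indS u v uS vS | indS u uS].
  exact: (forall_inP (indS u uS)).
by apply/forall_inP => v vS; exact: indS.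
Qed.

(** * The algorithm *)

(** The index is a natural number, so that it names the same vertex in every prefix. Out of range
    the value is false, so the last vertex of a path counts as a gap. *)
Definition linked n (G : input n) (i : nat) : bool :=
  [exists u : 'I_n, exists v : 'I_n, [&& u == i :> nat, v == i.+1 :> nat & adj G u v]].

Lemma linkedP n (G : input n) i :
  reflect (exists u v : 'I_n, [/\ u = i :> nat, v = i.+1 :> nat & adj G u v])
          (linked G i).
Proof.
apply: (iffP existsP) => [[u /existsP[v /and3P[/eqP ui /eqP vi uv]]] | [u [v [ui vi uv]]]].
  by exists u, v.
by exists u; apply/existsP; exists v; rewrite ui vi uv !eqxx.
Qed.

Lemma linkedE n (G : input n) (u v : 'I_n) :
  v = u.+1 :> nat -> linked G u = adj G u v.
Proof.
move=> vu; apply/linkedP/idP => [[u' [v' [u'u v'u uv]]] | uv]; last by exists u, v.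
have -> : u = u' by apply: val_inj.
by have -> : v = v' by apply: val_inj; rewrite /= vu v'u.
Qed.

Lemma linked_lt n (G : input n) i : linked G i -> (i.+1 < n)%N.
Proof. by case/linkedP => u [v [_ <- _]]. Qed.

Lemma linked_revealed m n (le_mn : (m <= n)%N) (G : input n) i :
  linked (revealed le_mn G) i = (i.+1 < m)%N && linked G i.
Proof.
have [lt_im /= | le_mi] := ltnP i.+1 m; last first.
  by apply/negbTE/negP => /linked_lt; rewrite ltnNge le_mi.
pose u := Ordinal (ltnW lt_im); pose v := Ordinal lt_im.
rewrite (@linkedE _ _ u v) // adj_revealed.
by rewrite -(@linkedE _ _ (widen_ord le_mn u) (widen_ord le_mn v)).
Qed.

Definition first_gap n (G : input n) (k : nat) : bool :=
  all (linked G) (iota 0 k) && ~~ linked G k.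

Lemma first_gap_inj n (G : input n) k l : first_gap G k -> first_gap G l -> k = l.
Proof.
wlog lt_kl : k l / (k < l)%N => [IH gk gl | /andP[_ gk] /andP[/allP gl _]].
  by case: (ltngtP k l) => // lt; [exact: IH | apply/esym; exact: IH].
by move: gk; rewrite gl // mem_iota.
Qed.

Lemma first_gap_exists n (G : input n) :
  (0 < n)%N -> exists2 k, (k < n)%N & first_gap G k.
Proof.
move=> n_gt0; have gap : exists k, ~~ linked G k.
  by exists n; apply/negP => /linked_lt; lia.
case: (ex_minnP gap) => k gk min_k.
have lk i : (i < k)%N -> linked G i by apply: contraLR => /min_k; lia.
exists k; last first.
  by rewrite /first_gap gk andbT; apply/allP => i; rewrite mem_iota => /lk.
have [-> // | k_gt0] := posnP k.
have /linked_lt : linked G k.-1 by apply: lk; lia.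
lia.
Qed.

(** Links below [k] involve only vertices up to [k], all among the first [m], and hiding later
    vertices creates no link at [k]. *)
Lemma first_gap_revealed m n (le_mn : (m <= n)%N) (G : input n) k :
  (k < m)%N -> first_gap G k -> first_gap (revealed le_mn G) k.
Proof.
move=> lt_km /andP[/allP lk gk]; apply/andP; split.
  by apply/allP => i ik; rewrite linked_revealed lk // andbT; move: ik; rewrite mem_iota; lia.
by rewrite linked_revealed negb_and gk orbT.
Qed.

(** A closed form in place of a state updated at each arrival. While consecutive arrivals are all
    adjacent, the gap is the latest vertex, which alone is accepted. *)
Definition hold_until_gap : online_algorithm := fun n G =>
  [set v : 'I_n | first_gap G v || (0 < v)%N && first_gap G v.-1].

Lemma hold_until_gap_independent n (G : input n) :
  independent G (hold_until_gap G).
Proof.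
have gap_succ (u v : 'I_n) : first_gap G u -> (0 < v)%N -> first_gap G v.-1 -> ~~ adj G u v.
  move=> gu v_gt0 gv; have uv : v = u.+1 :> nat by rewrite (first_gap_inj gu gv); lia.
  by rewrite -(@linkedE _ _ u v uv); case/andP: gu.
have eq_nadj (u v : 'I_n) : u = v :> nat -> ~~ adj G u v.
  by move=> /val_inj ->; rewrite adjnn.
apply/independentP => u v; rewrite !inE.
case/orP=> [gu | /andP[u_gt0 gu]] /orP[gv | /andP[v_gt0 gv]].
- exact/eq_nadj/(first_gap_inj gu gv).
- exact: gap_succ.
- by rewrite adjC; apply: gap_succ.
- by apply: eq_nadj; have := first_gap_inj gu gv; lia.
Qed.

Lemma hold_until_gap_late_reject : late_reject (@hold_until_gap).
Proof.
split=> [m H | m n le_mn G v]; first exact: hold_until_gap_independent.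
(* A vertex among the first [m] that is accepted later owes this to a gap below [m], which was
   already the first gap after [m] arrivals. *)
apply: contra; rewrite !inE /= => /orP[gv | /andP[-> gv]].
  by rewrite first_gap_revealed.
by rewrite [first_gap _ v.-1]first_gap_revealed ?orbT //; have := ltn_ord v; lia.
Qed.

Lemma card_nonconsecutive n (S : {set 'I_n}) :
  (forall u v : 'I_n, u \in S -> v \in S -> v <> u.+1 :> nat) ->
  (#|S| <= uphalf n)%N.
Proof.
move=> noS; have half_lt (v : 'I_n) : (v./2 < uphalf n)%N by have := ltn_ord v; lia.
(* Halving identifies just 2i and 2i+1, and [S] contains at most one of them, so [h] is injective on
   [S]. *)
pose h v := Ordinal (half_lt v).
rewrite -[leqRHS]card_ord -(@card_in_imset _ _ h) ?max_card // => u v uS vS.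
move=> /(congr1 val) /= eq_uv; apply: val_inj => /=.
by have := noS _ _ uS vS; have := noS _ _ vS uS; lia.
Qed.

Lemma OPT_path n (G : input n) :
  (forall u v : 'I_n, v = u.+1 :> nat -> adj G u v) -> (OPT G <= uphalf n)%N.
Proof.
move=> pathG; apply/bigmax_leqP => S /independentP indS.
by apply: card_nonconsecutive => u v uS vS /pathG; apply/negP/indS.
Qed.

Lemma OPT_le n (G : input n) : (OPT G <= n)%N.
Proof. by apply/bigmax_leqP => S _; rewrite -[leqRHS]card_ord max_card. Qed.

Lemma hold_until_gap_competitive n (G : input n) :
  (0 < n)%N -> (OPT G <= uphalf n * ALG (@hold_until_gap) G)%N.
Proof.
move=> n_gt0; have [k lt_kn gk] := first_gap_exists G n_gt0; rewrite /ALG.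
have kA : Ordinal lt_kn \in hold_until_gap G by rewrite inE /= gk.
have [lt_k1n | le_nk1] := ltnP k.+1 n.
  have k1A : Ordinal lt_k1n \in hold_until_gap G by rewrite inE /= gk orbT.
  have : (1 < #|hold_until_gap G|)%N.
    by apply/card_gt1P; exists (Ordinal lt_kn), (Ordinal lt_k1n); split=> //;
      rewrite -val_eqE /=; lia.
  by have := OPT_le G; nia.
(* Here [k] is the last vertex, so every consecutive pair starts below the gap and is adjacent. *)
have : (0 < #|hold_until_gap G|)%N by apply/card_gt0P; exists (Ordinal lt_kn).
have : (OPT G <= uphalf n)%N; last by nia.
apply: OPT_path => u v vu; rewrite -(@linkedE _ _ u v vu).
have /andP[/allP lk _] := gk.
by apply: lk; rewrite mem_iota; have := ltn_ord v; lia.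
Qed.

(** * The adversary *)

Section Extend.
Context {n : nat} (G : input n) (S : {set 'I_n}).

Let w := widen_ord (leqnSn n).

Definition extend_edges : {set {set 'I_n.+1}} :=
  [set w @: e | e : {set 'I_n} in edges G] :|: [set [set w u; ord_max] | u in S].

Let w_neq_max u : w u != ord_max.
Proof. by rewrite -val_eqE /= neq_ltn ltn_ord. Qed.

Lemma extend_edgesP : [forall e in extend_edges, #|e| == 2].
Proof.
apply/forall_inP => e /setUP[/imsetP[f fG ->] | /imsetP[u _ ->]].
  by rewrite card_imset; [exact: (forall_inP (edgesP G)) | exact: widen_ord_inj].
by rewrite cards2 w_neq_max.
Qed.

Definition extend : input n.+1 := Input extend_edgesP.

(** Lets the irrevocability of rejections relate the accepted set on [extend] to the one on [G]. *)
Lemma revealed_extend : revealed (leqnSn n) extend = G.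
Proof.
apply: input_inj; apply/setP => e; rewrite !inE.
have -> : (w @: e \in [set [set w u; ord_max] | u in S]) = false.
  apply/imsetP => -[u _ eq_e].
  have /imsetP[v _ /eqP] : ord_max \in w @: e by rewrite eq_e set22.
  by rewrite eq_sym (negPf (w_neq_max v)).
by rewrite orbF mem_imset //; apply/imset_inj/widen_ord_inj.
Qed.

Lemma adj_extend u v : adj extend (w u) (w v) = adj G u v.
Proof. by rewrite -adj_revealed revealed_extend. Qed.

Lemma adj_extend_max u : adj extend (w u) ord_max = (u \in S).
Proof.
apply/setUP/idP => [[/imsetP[f _ eq_f] | /imsetP[v vS eq_uv]] | uS].
- have /imsetP[v _ /eqP] : ord_max \in w @: f by rewrite -eq_f set22.
  by rewrite eq_sym (negPf (w_neq_max v)).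
- have : w u \in [set w v; ord_max] by rewrite -eq_uv set21.
  by rewrite !inE (negPf (w_neq_max u)) orbF => /eqP/widen_ord_inj ->.
- by right; apply/imsetP; exists u.
Qed.

(** Case split into old vertices and the new one, shaped as an eliminator for [elim/]. *)
Lemma extend_ordP (P : 'I_n.+1 -> Prop) :
  (forall u, P (w u)) -> P ord_max -> forall u, P u.
Proof.
move=> Pw Pmax u; have [-> // | u_neq] := eqVneq u ord_max.
have lt_un : (u < n)%N by move: u_neq; rewrite -val_eqE /=; have := ltn_ord u; lia.
by have -> : u = w (Ordinal lt_un) by apply: val_inj.
Qed.

End Extend.

(** The two invariants go through the induction together: at most one accepted vertex means that the
    new vertex has at most one neighbour, so a 2-colouring extends. Colours live on [nat] to stay
    typed as [n] grows. *)
Lemma adversary (A : online_algorithm) : late_reject A ->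
  forall n, exists2 G : input n, (#|A n G| <= 1)%N &
    exists f : nat -> bool, forall u v : 'I_n, adj G u v -> f u != f v.
Proof.
case=> indA lateA; elim=> [|n [G /card_le1_eqP A1 [f fG]]].
  have noE : [forall e in (set0 : {set {set 'I_0}}), #|e| == 2].
    by apply/forall_inP => e; rewrite inE.
  exists (Input noE); last by exists xpredT => -[].
  by rewrite (leq_trans (max_card _)) ?card_ord.
pose w := widen_ord (leqnSn n); pose G' := extend G (A n G).
have A'w u : w u \in A n.+1 G' -> u \in A n G.
  by apply: contraLR => uA; apply: lateA; rewrite revealed_extend.
(* An old vertex still accepted was accepted before, hence is a neighbour of the new one. *)
have A'max u : w u \in A n.+1 G' -> ord_max \in A n.+1 G' -> False.
  move=> uA mA; have /independentP/(_ _ _ uA mA)/negP := indA _ G'.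
  by rewrite adj_extend_max; apply; exact: A'w.
exists G'.
  apply/card_le1_eqP; elim/(@extend_ordP n) => [u|]; elim/(@extend_ordP n) => [v|] //.
  - by move=> /A'w uA /A'w vA; rewrite (A1 u v).
  - by move=> uA /(A'max _ uA).
  - by move=> mA /A'max/(_ mA).
(* The opposite of the colour of the only possible neighbour; [true] if there is none. *)
pose f' i := if (i < n)%N then f i else [forall u in A n G, ~~ f u].
have f'w (u : 'I_n) : f' (w u) = f u by rewrite /f' /= ltn_ord.
have f'max (u : 'I_n) : u \in A n G -> f u != f' n.
  move=> uA; rewrite /f' ltnn; case fu: (f u).
    by apply/eqP => /esym/forall_inP/(_ u uA); rewrite fu.
  by rewrite eq_sym eqbF_neg negbK; apply/forall_inP => v vA; rewrite (A1 u v) ?fu.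
exists f'; elim/(@extend_ordP n) => [u|]; elim/(@extend_ordP n) => [v|].
- by rewrite adj_extend !f'w => /fG.
- by rewrite adj_extend_max f'w => /f'max.
- by rewrite adjC adj_extend_max eq_sym f'w => /f'max.
- by rewrite adjnn.
Qed.

(** Both colour classes are independent and their sizes add up to [n], so the larger one
    suffices. *)
Lemma OPT_bipartite n (G : input n) (f : nat -> bool) :
  (forall u v : 'I_n, adj G u v -> f u != f v) -> (uphalf n <= OPT G)%N.
Proof.
move=> fG; pose C := [set u : 'I_n | f u].
have indC : independent G C.
  by apply/independentP => u v; rewrite !inE => fu fv; apply/negP => /fG; rewrite fu fv.
have indC' : independent G (~: C).
  apply/independentP => u v; rewrite !inE => /negPf fu /negPf fv.
  by apply/negP => /fG; rewrite fu fv.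
have leC : (#|C| <= OPT G)%N by exact: (leq_bigmax_cond (F := fun S : {set 'I_n} => #|S|)).
have leC' : (#|~: C| <= OPT G)%N by exact: (leq_bigmax_cond (F := fun S : {set 'I_n} => #|S|)).
by have := cardsC C; rewrite card_ord; lia.
Qed.

Theorem theorem2 (R : realType) :
  (exists A : online_algorithm, late_reject A /\
     forall n : nat, (1 <= n)%N ->
       strictly_competitive A n ((uphalf n)%:R : R)) /\
  (forall A : online_algorithm, late_reject A ->
     forall n : nat, (1 <= n)%N ->
     forall c : R, 0 <= c -> strictly_competitive A n c ->
       (uphalf n)%:R <= c).
Proof.
split.
  exists (@hold_until_gap); split; first exact: hold_until_gap_late_reject.
  move=> n n_gt0 G; rewrite -natrM ler_nat.
  exact: hold_until_gap_competitive.
move=> A lateA n _ c c_ge0 compA.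
have [G A1 [f fG]] := adversary lateA n.
apply: (le_trans (y := (OPT G)%:R)); first by rewrite ler_nat (OPT_bipartite fG).
(* From [c_ge0] and [A1], the product of [c] with the algorithm's value is at most [c]. *)
by apply: (le_trans (compA G)); rewrite ler_piMr // lern1.
Qed.
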